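(* Let $G$ be a finite simple graph with non-empty edge set, let $K$ be a field and let $A(G)=K[E_G]/I(G)$ be the Eulerian Artinian algebra of $G$. The Hilbert series of $A(G)$, in the variable $z$, is $$\sum_{(T,p)\in\mathcal{T}_{\mathrm{p},G}} z^{\tau(T,p)},$$ and, fixing any ordering of $E_G$, it is also equal to $\sum_{J} z^{|J|}$, where $J$ varies in the set of reduced parity joins of $G$.
   Context: $G$ is a finite simple undirected graph with vertex set $V_G$ and non-empty edge set $E_G$ (each edge is a 2-element subset of $V_G$); $K$ is any field. $K[E_G]=K[t_e : e\in E_G]$ is the standard graded polynomial ring. For $J\subseteq E_G$, $\mathbf{t}_J=\prod_{e\in J}t_e$. $\triangle$ denotes symmetric difference of sets. For $C\subseteq E_G$ and $v\in V_G$, $\deg_C(v)$ is the number of edges of $C$ containing $v$. $C$ is Eulerian if $\deg_C(v)$ is even for every $v\in V_G$. An Eulerian binomial is $\mathbf{t}_J-\mathbf{t}_L$ where $J,L\subseteq E_G$ are non-empty, $J\cap L=\emptyset$, $|J|=|L|$ and $J\cup L$ is Eulerian. $I(G)$ is the ideal of $K[E_G]$ generated by all Eulerian binomials and all $t_e^2$, $e\in E_G$; $A(G)=K[E_G]/I(G)$. Its Hilbert series is $\sum_{d\ge0}\dim_K A(G)_d\, z^d$. A subset $J\subseteq E_G$ is a parity join if $|J\cap C|\le |C|/2$ (equivalently $|J\triangle C|\ge |J|$) for every Eulerian $C\subseteq E_G$ of even cardinality. Given an ordering $E_G=\{e_1,\dots,e_s\}$ of the edges, a parity join $J$ is reduced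 if, whenever $C\subseteq E_G$ is a non-empty, even cardinality Eulerian subset with $|J\cap C|=|C|/2$, then $J$ contains the last edge of $C$ (that of largest index). For $T\subseteq V_G$, a subset $J\subseteq E_G$ is a $T$-join if $T=\{v\in V_G : \deg_J(v)\text{ is odd}\}$. For $p\in\mathbb{Z}_2=\mathbb{Z}/2\mathbb{Z}$, a $(T,p)$-join is a $T$-join $J$ with $|J|+2\mathbb{Z}=p$. $\mathcal{T}_{\mathrm{p},G}$ is the set of pairs $(T,p)$, $T\subseteq V_G$, $p\in\mathbb{Z}_2$, admitting a $(T,p)$-join; for such a pair, $\tau(T,p)$ is the minimum cardinality of a $(T,p)$-join. *)

(* Defs.v *)
From HB Require Import structures.
From mathcomp Require Import all_boot all_order all_algebra.
From mathcomp Require Import boolp mpoly.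

Set Implicit Arguments.
Unset Strict Implicit.
Unset Printing Implicit Defensive.

Import GRing.Theory.

Local Open Scope ring_scope.
Local Open Scope quotient_scope.

Record graph := Graph {
  vertex : finType;
  edges : {set {set vertex}};
  edges_card2 : forall e, e \in edges -> #|e| = 2 }.

Definition edge (G : graph) : finType := {e : {set vertex G} | e \in edges G}.

Section Joins.

Variable G : graph.
Implicit Types (v : vertex G) (T : {set vertex G}) (p : 'Z_2).
Implicit Types C J L : {set edge G}.

Definition deg C v : nat := #|[set e in C | v \in val e]|.

Definition eulerian C : bool := [forall v, ~~ odd (deg C v)].

Definition parity_join J : bool :=
  [forall C, eulerian C && ~~ odd #|C| ==> (#|J :&: C| <= #|C|./2)%N].

(* The ordering of the edges is e_ 0, ..., e_ (s - 1), for a bijection e_. *)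
Definition contains_last_edge s (e_ : 'I_s -> edge G) J C : bool :=
  [exists i, [&& e_ i \in C, [forall j, (e_ j \in C) ==> (j <= i)%N]
                & e_ i \in J]].

Definition reduced_parity_join s (e_ : 'I_s -> edge G) J : bool :=
  parity_join J &&
  [forall C, [&& C != set0, ~~ odd #|C|, eulerian C
                & #|J :&: C| == #|C|./2] ==> contains_last_edge e_ J C].

Definition join_of T J : bool := T == [set v | odd (deg J v)].

Definition parity_join_of T p J : bool := join_of T J && (#|J|%:R == p).

Definition admissible_pairs : {set {set vertex G} * 'Z_2} :=
  [set Tp | [exists J, parity_join_of Tp.1 Tp.2 J]].

(* The default value #|edge G| bounds every #|J|, so it does not affect the
   minimum as soon as (T, p) is admissible. *)
Definition tau T p : nat :=
  \big[minn/#|edge G|]_(J | parity_join_of T p J) #|J|.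

Lemma tau_le T p J : parity_join_of T p J -> (tau T p <= #|J|)%N.
Proof.
move=> TpJ; rewrite /tau; have := mem_index_enum J.
elim: index_enum => // L r IHr; rewrite inE big_cons.
case/predU1P=> [<-|/IHr le_r]; first by rewrite TpJ geq_minl.
by case: ifP => // _; rewrite geq_min le_r orbT.
Qed.

Lemma tau_attained T p :
  (T, p) \in admissible_pairs ->
  exists2 J, parity_join_of T p J & tau T p = #|J|.
Proof.
rewrite inE => /existsP [J0 J0P] /=.
have [J JP Jmin] := arg_minnP (fun J : {set edge G} => #|J|) J0P.
exists J => //; apply/eqP; rewrite eqn_leq tau_le //= /tau.
elim/big_ind: _ => [|m n Jm Jn|L /Jmin //]; first exact: max_card.
by rewrite leq_min Jm.
Qed.

End Joins.

Section Ideal.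

Variable R : comNzRingType.

Definition generated_ideal (S : R -> Prop) (x : R) : Prop :=
  exists m (a g : 'I_m -> R),
    (forall i, S (g i)) /\ x = \sum_(i < m) a i * g i.

Lemma generated_ideal_gen (S : R -> Prop) x : S x -> generated_ideal S x.
Proof.
move=> Sx; exists 1%N, (fun=> 1), (fun=> x).
by rewrite big_ord1 mul1r.
Qed.

Lemma generated_ideal0 S : generated_ideal S 0.
Proof.
by exists 0%N, (fun=> 0), (fun=> 0); rewrite big_ord0; split=> // -[].
Qed.

Lemma generated_idealMD S c x y :
  generated_ideal S x -> generated_ideal S y -> generated_ideal S (c * x + y).
Proof.
move=> [m [a [g [Sg ->]]]] [n [b [h [Sh ->]]]].
exists (m + n)%N,
  (fun i => match split i with inl j => c * a j | inr k => b k end),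
  (fun i => match split i with inl j => g j | inr k => h k end); split.
  by move=> i; case: (split i).
rewrite big_split_ord mulr_sumr /=; congr (_ + _); apply: eq_bigr => i _.
  by rewrite (unsplitK (inl i)) mulrA.
by rewrite (unsplitK (inr i)).
Qed.

End Ideal.

Section EulerianAlgebra.

Variables (G : graph) (K : fieldType).

(* The numbering enum_rank of the variables is unrelated to the ordering of the
   edges that enters reduced_parity_join. *)
Definition t_ (e : edge G) : {mpoly K[#|edge G|]} := 'X_(enum_rank e).

Definition t_set (J : {set edge G}) : {mpoly K[#|edge G|]} :=
  \prod_(e in J) t_ e.

Definition eulerian_binomial (f : {mpoly K[#|edge G|]}) : Prop :=
  exists J L : {set edge G},
    [/\ J != set0 /\ L != set0, J :&: L = set0, #|J| = #|L|,
        eulerian (J :|: L) & f = t_set J - t_set L].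

Definition eulerian_generator (f : {mpoly K[#|edge G|]}) : Prop :=
  eulerian_binomial f \/ exists e, f = t_ e ^+ 2.

Definition eulerian_ideal : {mpoly K[#|edge G|]} -> bool :=
  fun f => `[< generated_ideal eulerian_generator f >].

Lemma t_set_at0 J : J != set0 -> (t_set J).@[fun=> 0] = 0.
Proof.
case/set0Pn=> e eJ; rewrite /t_set (bigD1 e) //= mevalM mevalXU.
by rewrite mul0r.
Qed.

Lemma eulerian_idealr : idealr_closed eulerian_ideal.
Proof.
split; first by apply/asboolP; apply: generated_ideal0.
  apply/asboolP => -[m [a [g [Sg]]]] /(congr1 (meval (fun=> 0))).
  rewrite meval1 raddf_sum big1 => [/eqP|i _]; first by rewrite oner_eq0.
  have [[J [L [[J0 L0] _ _ _ ->]]]|[e ->]] /= := Sg i.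
    by rewrite mevalM mevalB !t_set_at0 // subr0 mulr0.
  by rewrite mevalM rmorphXn /= mevalXU expr0n mulr0.
move=> c x y /asboolP xI /asboolP yI; apply/asboolP.
exact: generated_idealMD.
Qed.

HB.instance Definition _ :=
  isIdealr.Build {mpoly K[#|edge G|]} eulerian_ideal eulerian_idealr.

Definition eulerian_algebra :=
  {ideal_quot (eulerian_ideal : idealr {mpoly K[#|edge G|]})}.

HB.instance Definition _ := GRing.ComNzRing.on eulerian_algebra.

Local Notation A := eulerian_algebra.

Definition to_algebra (f : {mpoly K[#|edge G|]}) : A := \pi f.

Lemma to_algebra_eq f g :
  to_algebra f = to_algebra g <-> generated_ideal eulerian_generator (f - g).
Proof.
have eqE := Quotient.idealrBE (eulerian_ideal : idealr _) f g.
by split=> [/eqP fg|fg]; [|apply/eqP]; move: fg; rewrite -eqE => /asboolP.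
Qed.

Lemma to_algebra_surj (a : A) : exists f, a = to_algebra f.
Proof. by exists (repr a); rewrite /to_algebra reprK. Qed.

Lemma to_algebra_zmod_morphism : zmod_morphism to_algebra.
Proof. by move=> f g; rewrite /to_algebra rmorphB. Qed.

Lemma to_algebra_monoid_morphism : monoid_morphism to_algebra.
Proof. by split=> [|f g]; rewrite /to_algebra ?rmorph1 ?rmorphM. Qed.

HB.instance Definition _ := GRing.isZmodMorphism.Build
  {mpoly K[#|edge G|]} A to_algebra to_algebra_zmod_morphism.
HB.instance Definition _ := GRing.isMonoidMorphism.Build
  {mpoly K[#|edge G|]} A to_algebra to_algebra_monoid_morphism.

Definition scale_algebra (c : K) (a : A) : A := to_algebra c%:MP * a.

Lemma scale_algebraA c d a :
  scale_algebra c (scale_algebra d a) = scale_algebra (c * d) a.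
Proof. by rewrite /scale_algebra mpolyCM rmorphM mulrA. Qed.

Lemma scale_algebra1 : left_id 1 scale_algebra.
Proof. by move=> a; rewrite /scale_algebra rmorph1 mul1r. Qed.

Lemma scale_algebraDr : right_distributive scale_algebra +%R.
Proof. by move=> c a b; rewrite /scale_algebra mulrDr. Qed.

Lemma scale_algebraDl a : {morph scale_algebra^~ a : c d / c + d}.
Proof. by move=> c d; rewrite /scale_algebra mpolyCD rmorphD mulrDl. Qed.

HB.instance Definition _ := GRing.Zmodule_isLmodule.Build K A
  scale_algebraA scale_algebra1 scale_algebraDr scale_algebraDl.

Lemma to_algebra_scalable : scalable to_algebra.
Proof.
by move=> c f; rewrite -mul_mpolyC rmorphM.
Qed.

HB.instance Definition _ := GRing.isScalable.Build
  K {mpoly K[#|edge G|]} A *:%R to_algebra to_algebra_scalable.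

Definition graded_piece (d : nat) (a : A) : Prop :=
  exists f : {mpoly K[#|edge G|]}, f \is d.-homog /\ a = to_algebra f.

End EulerianAlgebra.

Definition has_dim (K : fieldType) (V : lmodType K) (W : V -> Prop) (n : nat) :
    Prop :=
  exists b : 'I_n -> V,
    (forall v, W v <-> exists c : 'I_n -> K, v = \sum_(i < n) c i *: b i) /\
    (forall c : 'I_n -> K, \sum_(i < n) c i *: b i = 0 -> forall i, c i = 0).

(* The Hilbert series is given by its coefficients, z being 'X; asking for a
   polynomial P loses nothing, since A(G) is finite-dimensional. *)
Definition hilbert_series_is (G : graph) (K : fieldType) (P : {poly nat}) :
    Prop :=
  forall d, has_dim (@graded_piece G K d) (P`_d)%R.

(* Main.v *)
(** Two edge sets are put in the same class when they are joins of the same pair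
(T, p), i.e. when their symmetric difference is Eulerian of even cardinality.
Modulo I(G), the monomials t_J and t_L agree when J and L have the same class and
the same size, and t_J vanishes when its class contains a smaller join. So A(G) is
spanned by one monomial per class, of degree tau(T, p). These are independent
because the sum of the coefficients of the minimal (T, p)-joins is a linear
functional vanishing on I(G): if M and J are disjoint with M :|: J minimal, and J, L
have the same class and size, minimality forces M and L to be disjoint.
Parity joins are exactly the minimal elements of the classes, and the reduced one in
a class is the one of largest weight when the i-th edge weighs 2 ^ i. *)

From HB Require Import structures.
Require Import Defs.
From mathcomp Require Import all_boot all_order all_algebra.
From mathcomp Require Import mpoly zify.

Set Implicit Arguments.
Unset Strict Implicit.
Unset Printing Implicit Defensive.

Import GRing.Theory.

Local Open Scope ring_scope.

(** * Symmetric differences of finite sets and their cardinalities *)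

Section SymmetricDifference.

Variable T : finType.
Implicit Types A B C : {set T}.

Definition symdiff A B := (A :\: B) :|: (B :\: A).

Lemma in_symdiff A B x : (x \in symdiff A B) = (x \in A) (+) (x \in B).
Proof. by rewrite !inE; case: (x \in A); case: (x \in B). Qed.

Lemma symdiffK A B : symdiff A (symdiff A B) = B.
Proof. by apply/setP=> x; rewrite !in_symdiff addKb. Qed.

Lemma symdiff_eq0 A B : (symdiff A B == set0) = (A == B).
Proof.
apply/eqP/eqP=> [AB0 | ->]; last first.
  by apply/setP=> x; rewrite in_symdiff addbb inE.
by rewrite -(symdiffK A B) AB0; apply/setP=> x; rewrite in_symdiff inE addbF.
Qed.

Lemma symdiffIl A B C : symdiff A B :&: C = symdiff (A :&: C) (B :&: C).
Proof.
by apply/setP=> x; rewrite !inE; case: (x \in A); case: (x \in B);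
  case: (x \in C).
Qed.

Lemma setI_symdiff A B : A :&: symdiff A B = A :\: B.
Proof. by apply/setP=> x; rewrite !inE; case: (x \in A); case: (x \in B). Qed.

Lemma symdiff_disjoint A B : A :&: B = set0 -> symdiff A B = A :|: B.
Proof.
by move/setP=> AB0; apply/setP=> x; have := AB0 x; rewrite !inE;
  case: (x \in A); case: (x \in B).
Qed.

Lemma symdiff_subset A B : B \subset A -> symdiff A B = A :\: B.
Proof. by rewrite -setD_eq0 /symdiff => /eqP->; rewrite setU0. Qed.

Lemma card_symdiff A B :
  (#|symdiff A B| + #|A :&: B|.*2)%N = (#|A| + #|B|)%N.
Proof.
rewrite cardsU; have -> : (A :\: B) :&: (B :\: A) = set0.
  by apply/setP=> x; rewrite !inE; case: (x \in A); case: (x \in B).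
by rewrite cards0 subn0 -(cardsID B A) -(cardsID A B) (setIC B A); lia.
Qed.

Lemma odd_card_symdiff A B : odd #|symdiff A B| = odd #|A| (+) odd #|B|.
Proof.
by rewrite -oddD -card_symdiff oddD odd_double addbF.
Qed.

Lemma exists_subset_card A k :
  (k <= #|A|)%N -> exists2 B : {set T}, B \subset A & #|B| = k.
Proof.
move=> kA; exists [set x in take k (enum A)].
  by apply/subsetP=> x; rewrite inE => /mem_take; rewrite mem_enum.
rewrite cardsE (card_uniqP _) ?take_uniq ?enum_uniq // size_takel //.
by rewrite -cardE.
Qed.

End SymmetricDifference.

Lemma natr_Z2_eq m n : (m%:R == n%:R :> 'Z_2) = (odd m == odd n).
Proof.
by rewrite -val_eqE /= !val_Zp_nat // !modn2; case: (odd m); case: (odd n).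
Qed.

(** * Classes of edge sets and their minimal elements *)

Section JoinClasses.

Variable G : graph.
Implicit Types (J L M C : {set edge G}) (Tp : {set vertex G} * 'Z_2).

Definition join_class J : {set vertex G} * 'Z_2 :=
  ([set v | odd (deg J v)], #|J|%:R).

Lemma parity_join_ofE Tp J :
  parity_join_of Tp.1 Tp.2 J = (join_class J == Tp).
Proof. by rewrite /parity_join_of /join_of /join_class -pair_eqE /= eq_sym. Qed.

Lemma odd_deg_symdiff J L v :
  odd (deg (symdiff J L) v) = odd (deg J v) (+) odd (deg L v).
Proof.
have degE C : deg C v = #|C :&: [set e : edge G | v \in val e]|.
  by apply: eq_card => e; rewrite !inE.
by rewrite !degE symdiffIl odd_card_symdiff.
Qed.

Lemma join_class_eqP J L :
  reflect ((forall v, odd (deg J v) = odd (deg L v)) /\ odd #|J| = odd #|L|)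
          (join_class J == join_class L).
Proof.
rewrite -pair_eqE /= natr_Z2_eq; apply: (iffP andP) => [[/eqP/setP JL /eqP]|].
  by split=> // v; have := JL v; rewrite !inE.
by case=> JL ->; split=> //; apply/eqP/setP=> v; rewrite !inE JL.
Qed.

(** Degree parities and the parity of the cardinality are additive under symmetric difference, so a
    class is a coset of the even Eulerian sets. *)
Lemma join_class_symdiff J L :
  (join_class J == join_class L) =
    eulerian (symdiff J L) && ~~ odd #|symdiff J L|.
Proof.
rewrite odd_card_symdiff; apply/join_class_eqP/andP.
  move=> [JL ->]; rewrite addbb; split=> //; apply/forallP=> v.
  by rewrite odd_deg_symdiff JL addbb.
move=> [/forallP JL oddJL]; split=> [v|]; last first.
  by move: oddJL; case: (odd #|J|); case: (odd #|L|).
by have := JL v; rewrite odd_deg_symdiff; case: (odd _); case: (odd _).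
Qed.

Lemma join_class_symdiffl M J L :
  join_class J = join_class L ->
  join_class (symdiff M J) = join_class (symdiff M L).
Proof.
move/eqP/join_class_eqP=> [JL oddJL]; apply/eqP/join_class_eqP.
by rewrite !odd_card_symdiff oddJL; split=> // v; rewrite !odd_deg_symdiff JL.
Qed.

Lemma tau_le_card J : (tau (join_class J).1 (join_class J).2 <= #|J|)%N.
Proof. by apply: tau_le; rewrite parity_join_ofE. Qed.

Definition minimal_join Tp J : bool :=
  (join_class J == Tp) && (#|J| == tau Tp.1 Tp.2).

Lemma minimal_join_exists Tp :
  Tp \in admissible_pairs G -> exists J, minimal_join Tp J.
Proof.
case: Tp => T p /tau_attained [J TpJ tauJ]; exists J.
by rewrite /minimal_join -parity_join_ofE TpJ /= tauJ.
Qed.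

Lemma minimal_join_admissible Tp J :
  minimal_join Tp J -> Tp \in admissible_pairs G.
Proof.
by move=> /andP [JTp _]; rewrite inE; apply/existsP; exists J;
  rewrite parity_join_ofE.
Qed.

Lemma minimal_join_le Tp J L :
  minimal_join Tp J -> join_class L = Tp -> (#|J| <= #|L|)%N.
Proof. by move=> /andP [_ /eqP->] <-; apply: tau_le_card. Qed.

End JoinClasses.

(** * Monomials modulo the Eulerian ideal *)

Section MonomialsInAlgebra.

Variables (G : graph) (K : fieldType).
Implicit Types (J L M N : {set edge G}) (Tp : {set vertex G} * 'Z_2).

Local Notation n := #|edge G|.
Local Notation pi := (@to_algebra G K).
Local Notation t J := (@t_set G K J).

Lemma generator_to_algebra f : eulerian_generator f -> pi f = 0.
Proof.
move=> fgen; rewrite -(rmorph0 pi); apply/to_algebra_eq; rewrite subr0.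
exact: generated_ideal_gen.
Qed.

Lemma t_setU J L : J :&: L = set0 -> t (J :|: L) = t J * t L.
Proof.
move=> JL0; rewrite /t_set -bigU /=; last by rewrite -setI_eq0 JL0.
by apply: eq_bigl => e; rewrite !inE.
Qed.

Lemma t_setID J L : t J = t (J :&: L) * t (J :\: L).
Proof.
rewrite -t_setU ?setID //.
by apply/setP=> e; rewrite !inE; case: (e \in L); rewrite ?andbF.
Qed.

(** After the common factor [t (J :&: L)] is removed, the difference of the two cofactors is an
    Eulerian binomial, unless [J = L]. *)
Lemma to_algebra_t_eq J L :
  join_class J = join_class L -> #|J| = #|L| -> pi (t J) = pi (t L).
Proof.
move=> /eqP JL cJL; have [-> //|neqJL] := eqVneq J L.
rewrite (t_setID J L) (t_setID L J) !rmorphM /= (setIC L J); congr (_ * _).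
have cD : #|J :\: L| = #|L :\: J|.
  by have := cardsID L J; have := cardsID J L; rewrite (setIC L J); lia.
have D0 : (J :\: L != set0) && (L :\: J != set0).
  rewrite -!card_gt0 -cD andbb card_gt0; apply: contraNneq neqJL => D0.
  by rewrite eqEcard -setD_eq0 D0 eqxx cJL /=.
apply/eqP; rewrite -subr_eq0 -rmorphB; apply/eqP/generator_to_algebra; left.
exists (J :\: L), (L :\: J); split=> //; first exact/andP.
  by apply/setP=> e; rewrite !inE; case: (e \in J); case: (e \in L).
by move: JL; rewrite join_class_symdiff => /andP [].
Qed.

(* Moving half of the surplus [J \: L] from [J] to [L] produces two joins of
   equal size in a common class, and the moved edges appear squared. *)
Lemma to_algebra_t_eq0 J L :
  join_class J = join_class L -> (#|L| < #|J|)%N -> pi (t J) = 0.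
Proof.
move=> JL ltLJ; have [_ oddJL] := join_class_eqP _ _ (introT eqP JL).
(* The surplus is even and positive, so [k > 0], and [#|J| - k = #|L| + k]. *)
pose k := (#|J| - #|L|)./2.
have [D sD cD] : exists2 D : {set edge G}, D \subset J :\: L & #|D| = k.
  apply: exists_subset_card.
  by have := cardsID L J; have := subset_leq_card (subsetIr J L); lia.
have [sDJ DL0] : D \subset J /\ D :&: L = set0.
  move: sD; rewrite subsetD => /andP [-> dDL].
  by split=> //; apply/eqP; rewrite setI_eq0.
have [e eD] : exists e, e \in D by apply/set0Pn; rewrite -card_gt0; lia.
have class_eq : join_class (J :\: D) = join_class (D :|: L).
  rewrite -(symdiff_subset sDJ) -(symdiff_disjoint DL0).
  rewrite -(join_class_symdiffl D JL); congr join_class.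
  by apply/setP=> x; rewrite !in_symdiff addbC.
have card_eq : #|J :\: D| = #|D :|: L|.
  by rewrite cardsU DL0 cards0 cardsDS //; have := subset_leq_card sDJ; lia.
(* In the quotient [t J = t D * t (J :\: D) = t D * t (D :|: L) = t D * t D * t L], a multiple of
   the square of [t_ e]. *)
rewrite (t_setID J D) (setIidPr sDJ) rmorphM /= (to_algebra_t_eq class_eq) //.
rewrite t_setU // -rmorphM mulrA /t_set (bigD1 e) //=.
rewrite mulrACA -(mulrA (t_ K e * t_ K e)) rmorphM.
by rewrite [X in X * _]generator_to_algebra ?mul0r //; right; exists e.
Qed.

Definition join_mnm J : 'X_{1..n} := [multinom (enum_val i \in J : nat) | i < n].

Lemma join_mnmE J e : join_mnm J (enum_rank e) = (e \in J).
Proof. by rewrite mnmE enum_rankK. Qed.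

Lemma t_setE J : t J = 'X_[join_mnm J].
Proof.
rewrite /t_set /t_ -(big_morph _ (@mpolyXD n K) (@mpolyX0 n K)).
congr 'X_[_]; apply/mnmP=> i.
rewrite mnm_sumE mnmE -{1}(enum_valK i).
under eq_bigr => e _ do rewrite mnm1E (inj_eq enum_rank_inj).
case: (boolP (enum_val i \in J)) => [iJ|iNJ].
  by rewrite (bigD1 (enum_val i)) //= eqxx big1 // => e /andP [_ /negbTE->].
by rewrite big1 // => e eJ; case: eqP eJ iNJ => // -> ->.
Qed.

Lemma join_mnm_inj : injective join_mnm.
Proof.
move=> J L /mnmP JL; apply/setP=> e; have := JL (enum_rank e).
by rewrite !join_mnmE; case: (e \in J); case: (e \in L).
Qed.

Lemma join_mnmU J L :
  J :&: L = set0 -> join_mnm (J :|: L) = (join_mnm J + join_mnm L)%MM.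
Proof.
move/setP=> JL0; apply/mnmP=> i; have := JL0 (enum_val i).
by rewrite mnmDE !mnmE !inE; case: (_ \in J); case: (_ \in L).
Qed.

Lemma mdeg_join_mnm J : mdeg (join_mnm J) = #|J|.
Proof.
rewrite mdegE (reindex_onto (@enum_rank (edge G)) enum_val) /=; last first.
  by move=> i _; apply: enum_valK.
under eq_bigl => e do rewrite enum_rankK eqxx.
under eq_bigr => e _ do rewrite join_mnmE.
by rewrite -sum1_card [RHS]big_mkcond /=; apply: eq_bigr => e _; case: ifP.
Qed.

(** An exponent of at least 2 makes the monomial a multiple of some generator [t_ e ^+ 2]; otherwise
    the exponent vector is the indicator of an edge set. *)
Lemma to_algebra_mnm (k : 'X_{1..n}) :
  pi 'X_[k] = 0 \/ exists J, k = join_mnm J.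
Proof.
have [/forallP sqfree|] := boolP [forall i, (k i <= 1)%N].
  right; exists [set e | k (enum_rank e) != 0%N]; apply/mnmP=> i.
  by rewrite mnmE inE enum_valK; case: (k i) (sqfree i) => [|[]].
rewrite negb_forall => /existsP [i]; rewrite -ltnNge => ki; left.
have -> : k = ((k - U_(i) *+ 2) + U_(i) *+ 2)%MM.
  apply/mnmP=> j; rewrite mnmDE mnmBE mulmnE mnm1E.
  have [<-|_] := eqVneq i j; last by rewrite mul0n subn0 addn0.
  by rewrite mul1n subnK.
rewrite mpolyXD rmorphM /= [pi 'X_[_ *+ _]]generator_to_algebra ?mulr0 //.
by right; exists (enum_val i); rewrite /t_ enum_valK -mpolyXn.
Qed.

(** * Linear functionals that vanish on the ideal *)

Definition class_coeff Tp (f : {mpoly K[n]}) : K :=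
  \sum_(J | minimal_join Tp J) f@_(join_mnm J).

Lemma class_coeffX Tp k :
  class_coeff Tp 'X_[k] =
    [exists J, minimal_join Tp J && (k == join_mnm J)]%:R.
Proof.
rewrite /class_coeff; under eq_bigr => J _ do rewrite mcoeffX.
case: existsP => [[J /andP [JTp /eqP->]]|none].
  rewrite (bigD1 J) //= eqxx big1 ?addr0 // => L /andP [_ neqLJ].
  by rewrite (inj_eq join_mnm_inj) eq_sym (negbTE neqLJ).
rewrite big1 // => J JTp; case: eqP => // kJ; case: none; exists J.
by rewrite JTp kJ /=.
Qed.

Lemma class_coeff_scalar Tp : scalar (class_coeff Tp).
Proof.
move=> c f g; rewrite /class_coeff mulr_sumr -big_split /=.
by apply: eq_bigr => J _; rewrite mcoeffD mcoeffZ.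
Qed.

HB.instance Definition _ Tp := GRing.isLinear.Build K {mpoly K[n]} K *%R
  (class_coeff Tp) (class_coeff_scalar Tp).

(** Used in both directions, this gives the two terms of an Eulerian binomial, multiplied by a
    common monomial, the same [class_coeff]. *)
Lemma minimal_join_exchange Tp J L k :
    J :&: L = set0 -> #|J| = #|L| -> eulerian (J :|: L) ->
  [exists N, minimal_join Tp N && ((k + join_mnm J)%MM == join_mnm N)] ->
  [exists N, minimal_join Tp N && ((k + join_mnm L)%MM == join_mnm N)].
Proof.
move=> JL0 cJL eulJL /existsP [N /andP [NTp /eqP kN]].
have JL : join_class J = join_class L.
  apply/eqP; rewrite join_class_symdiff symdiff_disjoint // eulJL /=.
  by rewrite cardsU JL0 cards0 cJL; lia.
pose M := N :\: J.
(* The exponents of [k + join_mnm J] are those of the indicator of [N], hence [J] lies in [N] and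
   [k] is the indicator of [N :\: J]. *)
have sJN : J \subset N.
  apply/subsetP=> e eJ; have := congr1 (fun m : 'X_{1..n} => m (enum_rank e)) kN.
  by rewrite /= mnmDE !join_mnmE eJ; case: (e \in N) => //; lia.
have MJ0 : M :&: J = set0.
  by apply/setP=> e; rewrite !inE; case: (e \in J); rewrite ?andbF.
have defN : M :|: J = N.
  by apply/setP=> e; have := subsetP sJN e; rewrite !inE;
    case: (e \in J); case: (e \in N) => // /(_ isT).
have kM : k = join_mnm M.
  by apply: (@addIm _ (join_mnm J)); rewrite kN -join_mnmU // defN.
have [classN sizeN] := andP NTp.
have classML : join_class (symdiff M L) = Tp.
  by rewrite -(join_class_symdiffl M JL) symdiff_disjoint // defN; apply/eqP.
have cN : #|N| = (#|M| + #|J|)%N by rewrite -defN cardsU MJ0 cards0 subn0.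
(* [symdiff M L] has the class of [N] but [2 * #|M :&: L|] fewer elements, so minimality of [N]
   excludes any overlap. *)
have ML0 : M :&: L = set0.
  apply/eqP; rewrite -cards_eq0.
  by have := minimal_join_le NTp classML; have := card_symdiff M L; lia.
apply/existsP; exists (symdiff M L).
rewrite /minimal_join classML eqxx /= -(eqP sizeN) symdiff_disjoint //.
by rewrite cardsU ML0 cards0 subn0 cN cJL eqxx /= kM join_mnmU.
Qed.

(** Binomials are handled by the exchange; a multiple of [t_ e ^+ 2] is not squarefree, so it is the
    monomial of no join. *)
Lemma class_coeff_generator Tp k f :
  eulerian_generator f -> class_coeff Tp ('X_[k] * f) = 0.
Proof.
move=> [[J [L [[J0 L0] JL0 cJL eulJL ->]]]|[e ->]].
  rewrite !t_setE mulrBr -!mpolyXD linearB /= !class_coeffX.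
  apply/eqP; rewrite subr_eq0; apply/eqP; congr (_%:R); congr (nat_of_bool _).
  apply/idP/idP; apply: minimal_join_exchange => //.
    by rewrite setIC.
  by rewrite setUC.
rewrite /t_ mpolyXn -mpolyXD class_coeffX.
case: existsP => // -[J /andP [_ /eqP kJ]].
have := congr1 (fun m : 'X_{1..n} => m (enum_rank e)) kJ.
by rewrite /= join_mnmE mnmDE mulmnE mnm1E eqxx; case: (e \in J); lia.
Qed.

Lemma class_coeff_ideal Tp f : pi f = 0 -> class_coeff Tp f = 0.
Proof.
rewrite -(rmorph0 pi) => /to_algebra_eq; rewrite subr0.
move=> [m [a [g [ggen ->]]]]; rewrite linear_sum big1 // => i _ /=.
(* Expanding the coefficient [a i] into monomials reduces to monomial multiples of generators. *)
rewrite [a i]mpolyE mulr_suml linear_sum big1 // => k _ /=.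
by rewrite -scalerAl linearZ /= class_coeff_generator // mulr0.
Qed.

End MonomialsInAlgebra.

(** * A monomial basis of each graded piece *)

Section HilbertSeries.

Variables (G : graph) (K : fieldType).
Implicit Types (J L N : {set edge G}) (Tp : {set vertex G} * 'Z_2).

Local Notation pi := (@to_algebra G K).

Lemma has_dim_graded_piece d :
  has_dim (@graded_piece G K d)
    #|[set Tp in admissible_pairs G | tau Tp.1 Tp.2 == d]|.
Proof.
set S := [set Tp in _ | _].
(* The default [set0] never occurs on [S], as every admissible pair has a minimal join. *)
pose rep Tp : {set edge G} := odflt set0 [pick J | minimal_join Tp J].
have repP Tp : Tp \in S -> minimal_join Tp (rep Tp) /\ #|rep Tp| = d.
  rewrite inE => /andP [/minimal_join_exists [J JTp] /eqP <-]; rewrite /rep.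
  by case: pickP => [L LTp|/(_ J)]; [have /andP [_ /eqP] := LTp | rewrite JTp].
pose b (i : 'I_#|S|) := pi (t_set K (rep (enum_val i))).
exists b; split=> [v|c]; last first.
  (* Independence: the functional of the [i]-th class kills this lift of the vanishing combination,
     and its value there is [c i]. *)
  pose f := \sum_(i < #|S|) c i *: t_set K (rep (enum_val i)).
  have -> : \sum_i c i *: b i = pi f.
    by rewrite linear_sum; apply: eq_bigr => i _; rewrite linearZ.
  move=> /class_coeff_ideal f0 i; have := f0 (enum_val i).
  have classE j : class_coeff (enum_val i) (t_set K (rep (enum_val j)))
                    = (j == i)%:R.
    have [/andP [/eqP cj _] _] := repP _ (enum_valP j).
    have [Mi _] := repP _ (enum_valP i).
    rewrite t_setE class_coeffX; congr (_%:R); congr (nat_of_bool _).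
    apply/existsP/eqP => [[J /andP [/andP [/eqP cJ _] /eqP /join_mnm_inj eqJ]]|->].
      by apply: enum_val_inj; rewrite -cj -cJ eqJ.
    by exists (rep (enum_val i)); rewrite Mi eqxx.
  rewrite linear_sum (bigD1 i) //= linearZ /= classE eqxx mulr1 big1 ?addr0 //.
  by move=> j /negbTE neq_ji; rewrite linearZ /= classE neq_ji mulr0.
split=> [[f [homf ->]]|[c ->]]; last first.
  exists (\sum_(i < #|S|) c i *: t_set K (rep (enum_val i))); split.
    apply: rpred_sum => i _; apply: rpredZ.
    rewrite t_setE dhomogX /= mdeg_join_mnm.
    by have [_ /eqP] := repP _ (enum_valP i).
  by rewrite linear_sum; apply: eq_bigr => i _; rewrite linearZ.
(* Spanning: the span [W] is closed under sums and scalars, so it suffices to treat each monomial of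
   [f]. *)
pose W w := exists c : 'I_#|S| -> K, w = \sum_i c i *: b i.
have W0 : W 0 by exists (fun=> 0); rewrite big1 // => i _; rewrite scale0r.
have WD u w : W u -> W w -> W (u + w).
  move=> [c ->] [c' ->]; exists (fun i => c i + c' i).
  by rewrite -big_split /=; apply: eq_bigr => i _; rewrite scalerDl.
have WZ a w : W w -> W (a *: w).
  move=> [c ->]; exists (fun i => a * c i).
  by rewrite scaler_sumr; apply: eq_bigr => i _; rewrite scalerA.
have Wb i : W (b i).
  exists (fun j => (j == i)%:R); rewrite (bigD1 i) //= eqxx scale1r.
  by rewrite big1 ?addr0 // => j /negbTE->; rewrite scale0r.
rewrite [f]mpolyE linear_sum big_seq; apply: (big_ind W) => // k kf.
rewrite linearZ /=; apply: (WZ).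
have [->//|[N kN]] := to_algebra_mnm K k.
have cN : #|N| = d by rewrite -mdeg_join_mnm -kN; apply: dhomog_mf homf _ kf.
rewrite kN -t_setE; pose Tp := join_class N.
have TpA : Tp \in admissible_pairs G.
  by rewrite inE; apply/existsP; exists N; rewrite parity_join_ofE.
have [L LTp] := minimal_join_exists TpA.
have cLN : join_class N = join_class L by have /andP [/eqP] := LTp.
(* If the minimal join [L] is smaller than [N], the monomial of [N] vanishes; otherwise [tau] is [d]
   at this class and the monomial equals the chosen basis element. *)
have := minimal_join_le LTp (erefl : join_class N = Tp).
rewrite leq_eqVlt => /predU1P [cardLN|ltLN]; last first.
  by rewrite (to_algebra_t_eq0 K cLN).
have TpS : Tp \in S.
  by have [_ /eqP tauTp] := andP LTp; rewrite inE TpA -tauTp cardLN cN /=.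
have [/andP [/eqP repTp _] crep] := repP _ TpS.
suff -> : pi (t_set K N) = b (enum_rank_in TpS Tp) by [].
by rewrite /b enum_rankK_in //; apply: to_algebra_t_eq; rewrite // crep.
Qed.

Lemma hilbert_series_admissible :
  hilbert_series_is G K (\sum_(Tp in admissible_pairs G) 'X^(tau Tp.1 Tp.2)).
Proof.
move=> d; rewrite coef_sum.
suff -> : \sum_(Tp in admissible_pairs G) ('X^(tau Tp.1 Tp.2) : {poly nat})`_d
          = #|[set Tp in admissible_pairs G | tau Tp.1 Tp.2 == d]|.
  exact: has_dim_graded_piece.
rewrite -sum1_card big_mkcond [RHS]big_mkcond /=.
apply: eq_bigr => Tp _; rewrite [in RHS]in_set coefXn natn eq_sym.
by case: (Tp \in _) => //=; case: eqP.
Qed.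

End HilbertSeries.

(** * Reduced parity joins as representatives of the classes *)

Section ReducedJoins.

Variables (G : graph) (s : nat) (e_ : 'I_s -> edge G).
Hypothesis e_bij : bijective e_.
Implicit Types (J L C : {set edge G}) (Tp : {set vertex G} * 'Z_2).

(** The substitution [C = symdiff J L] matches even Eulerian sets [C] with members [L] of the class
    of [J]; then [J :&: C = J :\: L], which has at most half the elements of [C] exactly when
    [#|J| <= #|L|]. *)
Lemma parity_join_minimal J :
  parity_join J = minimal_join (join_class J) J.
Proof.
rewrite /minimal_join eqxx /=; apply/forallP/eqP=> [parJ|minJ].
  have [|L classL sizeL] := @tau_attained G (join_class J).1 (join_class J).2.
    by rewrite inE; apply/existsP; exists J; rewrite parity_join_ofE.
  suff leJL : (#|J| <= #|L|)%N.
    by apply/eqP; rewrite eqn_leq tau_le_card andbT sizeL.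
  move: classL; rewrite parity_join_ofE eq_sym join_class_symdiff => JL.
  have parJL : (#|J :\: L| <= #|symdiff J L|./2)%N.
    by have := parJ (symdiff J L); rewrite JL setI_symdiff.
  have := card_symdiff J L; have := cardsID L J.
  by case/andP: JL => _; lia.
move=> C; apply/implyP; rewrite -(symdiffK J C) -join_class_symdiff.
move: (symdiff J C) => L /eqP JL.
have leJL : (#|J| <= #|L|)%N by have := tau_le_card L; rewrite -JL -minJ.
suff : (#|J :\: L| <= #|symdiff J L|./2)%N by rewrite setI_symdiff.
by have := card_symdiff J L; have := cardsID L J; lia.
Qed.

Lemma contains_last_edgeP J C :
  reflect (exists i, [/\ e_ i \in C, forall j, e_ j \in C -> (j <= i)%N
                       & e_ i \in J])
          (contains_last_edge e_ J C).
Proof.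
apply: (iffP existsP) => -[i].
  by case/and3P=> iC /forallP last iJ; exists i; split=> // j jC;
    apply: (implyP (last j)).
case=> iC last iJ; exists i; rewrite iC iJ andbT /=.
by apply/forallP=> j; apply/implyP/last.
Qed.

(** Two reduced joins of one class have equal size, so each contains half of their symmetric
    difference. If it is non-empty, both contain its last edge, although no common edge lies in
    it. *)
Lemma reduced_join_inj :
  {in [pred J | reduced_parity_join e_ J] &, injective (@join_class G)}.
Proof.
move=> J L /andP [parJ /forallP redJ] /andP [parL /forallP redL] classJL.
apply/eqP; apply: contraT => neqJL.
rewrite parity_join_minimal in parJ; rewrite parity_join_minimal in parL.
have cJL : #|J| = #|L|.
  apply/eqP; rewrite eqn_leq (minimal_join_le parJ (esym classJL)).
  exact: minimal_join_le parL classJL.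
have symC : symdiff L J = symdiff J L by rewrite /symdiff setUC.
have JL := introT eqP classJL; rewrite join_class_symdiff in JL.
have [eulC evenC] := andP JL.
have D0 : symdiff J L != set0 by rewrite symdiff_eq0.
have cD := card_symdiff J L; have cJ := cardsID L J.
have cL := cardsID J L; rewrite (setIC L J) in cL.
have halfJ : #|J :&: symdiff J L| = #|symdiff J L|./2.
  by rewrite setI_symdiff; lia.
have halfL : #|L :&: symdiff J L| = #|symdiff J L|./2.
  by rewrite -[X in L :&: X]symC setI_symdiff; lia.
have := redJ (symdiff J L); have := redL (symdiff J L).
rewrite D0 eulC evenC halfJ halfL eqxx /=.
case/contains_last_edgeP=> i [iC lasti iL] /contains_last_edgeP [j [jC lastj jJ]].
have eqij : i = j by apply/val_inj/eqP; rewrite eqn_leq lastj ?lasti.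
by move: jC; rewrite in_symdiff jJ -eqij iL.
Qed.

(** Binary weights make the last edge of the symmetric difference decide which set is heavier. *)
Definition join_weight J : nat := \sum_(i < s | e_ i \in J) 2 ^ i.

Lemma join_weight_lt J L i :
    e_ i \in symdiff J L -> (forall j, e_ j \in symdiff J L -> (j <= i)%N) ->
  e_ i \notin J -> (join_weight J < join_weight L)%N.
Proof.
rewrite in_symdiff => + last iNJ; rewrite (negbTE iNJ) /= => iL.
(* The edges of [J :&: L] contribute equally and cancel; then [i] alone contributes [2 ^ i] to [L],
   more than all smaller indices together. *)
rewrite /join_weight (bigID (fun j => e_ j \in L)) /=.
rewrite [ltnRHS](bigID (fun j => e_ j \in J)) /=.
under [X in (_ < X + _)%N]eq_bigl => j do rewrite andbC.
rewrite ltn_add2l [ltnRHS](bigD1 i) ?iL //=; apply: ltn_addr.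
have ltX : (\sum_(j < s | (j < i)%N) 2 ^ j < 2 ^ i)%N.
  rewrite -(big_ord_widen _ (fun j => 2 ^ j)%N (ltnW (ltn_ord i))).
  have := predn_exp 2 i; rewrite mul1n => <-.
  by rewrite prednK ?expn_gt0.
apply: leq_ltn_trans ltX.
rewrite big_mkcond [leqRHS]big_mkcond; apply: leq_sum => j _.
case: andP => // -[jJ jNL]; rewrite ltn_neqAle last ?andbT; last first.
  by rewrite in_symdiff jJ (negbTE jNL).
by rewrite (_ : (j : nat) != i) //; apply: contraNneq iNJ => /val_inj <-.
Qed.

(** A minimal join [J] of maximal weight is reduced: if it missed the last edge of a set [C] that it
    halves, [symdiff J C] would be a heavier minimal join. *)
Lemma reduced_join_exists Tp :
  Tp \in admissible_pairs G ->
  exists2 J, reduced_parity_join e_ J & minimal_join Tp J.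
Proof.
case/minimal_join_exists=> J0 J0Tp.
have [J JTp maxJ] := arg_maxnP join_weight J0Tp; exists J => //.
have [/eqP classJ sizeJ] := andP JTp.
rewrite /reduced_parity_join parity_join_minimal classJ JTp /=.
apply/forallP=> C; apply/implyP=> /and4P [C0 evenC eulC /eqP halfC].
(* Surjectivity of [e_] provides an index of an edge of [C], from which a largest one is
   obtained. *)
have [e eC] := set0Pn _ C0; have [g _ gK] := e_bij.
have iC : e_ (g e) \in C by rewrite gK.
have [i iC' last] :=
  @arg_maxnP _ (g e) (fun i => e_ i \in C) (@nat_of_ord s) iC.
apply/contains_last_edgeP; exists i; split=> //; apply: contraT => iNJ.
have LTp : minimal_join Tp (symdiff J C).
  have /eqP classL : join_class J == join_class (symdiff J C).
    by rewrite join_class_symdiff symdiffK eulC.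
  have cardL : #|symdiff J C| = #|J|.
    by have := card_symdiff J C; rewrite halfC even_halfK // => /addIn.
  by rewrite /minimal_join -classL classJ eqxx cardL.
have : (join_weight (symdiff J C) <= join_weight J)%N := maxJ _ LTp.
rewrite leqNgt => /negP [].
by apply: (@join_weight_lt _ _ i) => [|j|//]; rewrite symdiffK // => /last.
Qed.

(** [join_class] maps the reduced parity joins bijectively onto the admissible pairs and sends size
    to [tau]. *)
Lemma sum_reduced_joins (R : pzSemiRingType) (F : nat -> R) :
  \sum_(Tp in admissible_pairs G) F (tau Tp.1 Tp.2) =
    \sum_(J | reduced_parity_join e_ J) F #|J|.
Proof.
have -> : admissible_pairs G =
    @join_class G @: [set J | reduced_parity_join e_ J].
  apply/setP=> Tp; apply/idP/imsetP => [/reduced_join_exists|[J]].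
    by case=> J redJ /andP [/eqP <- _]; exists J; rewrite ?inE.
  rewrite inE => /andP [+ _] ->; rewrite parity_join_minimal.
  exact: minimal_join_admissible.
rewrite big_imset /=; last first.
  by move=> J L; rewrite !inE => redJ redL; apply: reduced_join_inj.
apply: eq_big => [J|J]; rewrite inE // => /andP [+ _].
by rewrite parity_join_minimal => /andP [_ /eqP <-].
Qed.

End ReducedJoins.

Theorem corollary2p13 (G : graph) (K : fieldType) (hE : edges G != set0) :
  hilbert_series_is G K
    (\sum_(Tp in admissible_pairs G) 'X^(tau Tp.1 Tp.2)) /\
  forall (s : nat) (e_ : 'I_s -> edge G), bijective e_ ->
    hilbert_series_is G K
      (\sum_(J : {set edge G} | reduced_parity_join e_ J) 'X^#|J|).
Proof.
split=> [|s e_ e_bij]; first exact: hilbert_series_admissible.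
rewrite -(sum_reduced_joins e_bij (fun n => 'X^n)).
exact: hilbert_series_admissible.
Qed.
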